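(* In $\operatorname{PG}(7,2)$ the quadratic polynomial $$Q_2=x_1x_8+x_2x_7+x_3x_6+x_4x_5$$ is the unique polynomial of degree $2$ which is $\mathcal{G}_{\mathcal{S}}$-invariant. Consequently the Segre variety $\mathcal{O}_5=\mathcal{S}=\mathcal{S}_{1,1,1}(2)$ is a subset of the $\mathcal{G}_{\mathcal{S}}$-invariant hyperbolic quadric $\mathcal{H}_7=\mathcal{O}_2\cup\mathcal{O}_4\cup\mathcal{O}_5\subset\operatorname{PG}(7,2)$ having equation $Q_2(x)=0$.
   Context: Everything is over $\operatorname{GF}(2)$. Let $V_2$ be a 2-dimensional vector space over $\operatorname{GF}(2)$ with nonzero vectors $u_0,u_1,u_2$ (so $u_2=u_0+u_1$), and $V_8=V_2\otimes V_2\otimes V_2$. Points of $\operatorname{PG}(7,2)=\mathbb{P}V_8$ are identified with nonzero vectors of $V_8$. Put $E_{ijk}=u_i\otimes u_j\otimes u_k$ for $i,j,k\in\{0,1,2\}$. The Segre variety is the 27-point set $\mathcal{S}=\mathcal{S}_{1,1,1}(2)=\{E_{ijk}\}$; $\mathcal{G}_{\mathcal{S}}$ is its stabilizer in $\operatorname{GL}(V_8)$, equal to $\mathcal{N}\rtimes\operatorname{Sym}(3)$ where $\mathcal{N}=\operatorname{GL}(V_2)^3$ acts by maps $a_1\otimes a_2\otimes a_3$ and $\operatorname{Sym}(3)$ permutes the tensor factors. Coordinates $x_1,\dots,x_8$ are with respect to the basis $e_1=E_{000}$, $e_2=E_{100}$, $e_3=E_{110}$, $e_4=E_{010}$, $e_5=E_{101}$,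 $e_6=E_{001}$, $e_7=E_{011}$, $e_8=E_{111}$. Polynomials are taken with zero constant term and in reduced form, i.e. as sums of squarefree monomials $x_{i_1}\cdots x_{i_k}$, $k\ge1$, $i_1<\cdots<i_k$; degree means degree of the reduced form. $Q$ is $\mathcal{G}_{\mathcal{S}}$-invariant if $Q(Ax)=Q(x)$ for all $A\in\mathcal{G}_{\mathcal{S}}$, $x\in V_8$. The point sets $\mathcal{O}_i$ (the $\mathcal{G}_{\mathcal{S}}$-orbits of points) are: $\mathcal{O}_5=\mathcal{S}$; $\mathcal{O}_2$ is the set of points outside $\mathcal{S}$ lying in one of the nine 3-flats spanned by the 9-point subsets of $\mathcal{S}$ obtained by fixing one of the three indices of $E_{ijk}$; $\mathcal{O}_4$ is the set of points outside $\mathcal{S}$ lying on some distinguished tangent $L(p)$, $p\in\mathcal{S}$, where $L(p)=\{p,p',p''\}$ and $p',p''$ are the two points of the 3-flat spanned by the three generators through $p$ that lie in none of the three planes spanned by two of these generators (generators are the lines in $\mathcal{S}$ obtained by fixing two indices of $E_{ijk}$ and letting the third vary); $\mathcal{O}_3$ is the set of points $E_{ijk}+E_{i'j'k'}$ with $i\ne i'$, $j\ne j'$, $k\ne k'$; and $\mathcal{O}_1$ is the set of all remaining points. *)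

(* Defs.v *)
From mathcomp Require Import all_boot all_order all_algebra.
From mathcomp Require Import mxtens.
From mathcomp Require Import mpoly.

Set Implicit Arguments.
Unset Strict Implicit.
Unset Printing Implicit Defensive.

Import GRing.Theory.
Local Open Scope ring_scope.

(* V_2 is modelled as GF(2)^2 with u_0, u_1 the unit vectors,
   and V_2 (x) V_2 (x) V_2 as the Kronecker product space GF(2)^(2*2*2). *)
Definition V2 := 'rV['F_2]_2.
Definition V8 := 'rV['F_2]_(2 * 2 * 2).

Definition u (i : 'I_3) : V2 :=
  if i == 0 then delta_mx 0 0
  else if i == 1 then delta_mx 0 1
  else delta_mx 0 0 + delta_mx 0 1.

(* E [tuple i; j; k] is E_ijk. *)
Definition E (t : 3.-tuple 'I_3) : V8 :=
  u (tnth t 0) *t u (tnth t 1) *t u (tnth t 2).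

Definition segre : {set V8} := [set E t | t : 3.-tuple 'I_3].

(* Row vectors: the linear map with matrix A is x |-> x *m A. *)
Definition GS : {set 'M['F_2]_(2 * 2 * 2)} :=
  [set A | (A \in unitmx) && ([set x *m A | x in segre] == segre)].

Definition e : 8.-tuple V8 :=
  [tuple E [tuple 0; 0; 0]; E [tuple 1; 0; 0]; E [tuple 1; 1; 0];
         E [tuple 0; 1; 0]; E [tuple 1; 0; 1]; E [tuple 0; 0; 1];
         E [tuple 0; 1; 1]; E [tuple 1; 1; 1]].

(* Zero constant term, and every monomial squarefree. *)
Definition reduced (P : {mpoly 'F_2[8]}) : Prop :=
  forall m : 'X_{1..8}, m \in msupp P -> m <> 0%MM /\ forall i, (m i <= 1)%N.

(* msize is the total degree plus one. *)
Definition pdegree (P : {mpoly 'F_2[8]}) : nat := (msize P).-1.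

Definition pval (P : {mpoly 'F_2[8]}) (v : V8) : 'F_2 :=
  P.@[fun i => coord e i v].

Definition GS_invariant (P : {mpoly 'F_2[8]}) : Prop :=
  forall A, A \in GS -> forall v : V8, pval P (v *m A) = pval P v.

(* x_ k is the k-th coordinate variable for 1 <= k <= 8 (indices of 'X_i start
   at 0). *)
Definition x_ (k : nat) : {mpoly 'F_2[8]} := 'X_(inord k.-1).

Definition Q2 : {mpoly 'F_2[8]} :=
  x_ 1 * x_ 8 + x_ 2 * x_ 7 + x_ 3 * x_ 6 + x_ 4 * x_ 5.

Definition spanned (X : {set V8}) : {vspace V8} := <<enum X>>%VS.

(* The nine 3-flats: index a of E_ijk is fixed to the value c. *)
Definition flat3 (a c : 'I_3) : {vspace V8} :=
  spanned [set E t | t : 3.-tuple 'I_3 & tnth t a == c].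

Definition generator (a : 'I_3) (t : 3.-tuple 'I_3) : {set V8} :=
  [set E s | s : 3.-tuple 'I_3 & [forall b, (b != a) ==> (tnth s b == tnth t b)]].

Definition generators_through (p : V8) : {set {set V8}} :=
  [set G in [set generator a t | a : 'I_3, t : 3.-tuple 'I_3] | p \in G].

Definition distinguished_tangent (p : V8) : {set V8} :=
  p |: [set x | [&& x != 0, x \in spanned (cover (generators_through p)) &
                 [forall G in generators_through p,
                  forall H in generators_through p,
                    (G != H) ==> (x \notin spanned (G :|: H))]]].

Definition O5 : {set V8} := segre.

Definition O2 : {set V8} :=
  [set x | [&& x != 0, x \notin segre & [exists a, exists c, x \in flat3 a c]]].

Definition O4 : {set V8} :=
  [set x | [&& x != 0, x \notin segre &
            [exists p in segre, x \in distinguished_tangent p]]].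

Definition H7 : {set V8} := O2 :|: O4 :|: O5.

Section QuadraticForms.
Variables (F : fieldType) (V : vectType F).

Definition polar (q : V -> F) (x y : V) : F := q (x + y) - q x - q y.

(* Additivity in the second argument follows from the symmetry of polar. *)
Definition quadratic_form (q : V -> F) : Prop :=
  (forall (a : F) (x : V), q (a *: x) = a ^+ 2 * q x) /\
  (forall y : V, scalar (fun x => polar q x y)).

(* Nondegenerate of maximal Witt index on an even-dimensional space, i.e. the
   quadric q = 0 is hyperbolic. *)
Definition hyperbolic_form (q : V -> F) : Prop :=
  [/\ quadratic_form q,
      (forall x, (forall y, polar q x y = 0) -> x = 0) &
      exists U : {vspace V},
        (\dim {: V} = 2 * \dim U)%N /\ {in U, forall x, q x = 0}].

End QuadraticForms.

(* Main.v *)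
From mathcomp Require Import all_boot fingroup perm.
Require Import Defs.
From mathcomp Require Import all_boot all_order all_algebra.
From mathcomp Require Import mxtens.
From mathcomp Require Import mpoly.
From mathcomp Require Import ring.

(** Write q for the function x |-> Q_2(x) and B for its polar form. The form
    B is the tensor cube of the symplectic form of V_2, and two of the vectors
    u_0, u_1, u_2 have symplectic product 1 exactly when they differ. Hence q
    vanishes on the Segre variety S, and B (E s) (E t) = 1 exactly when the
    index triples s and t differ in all three places ([pvalQ2_E],
    [polarQ2_E]). As S spans V_8, a function with additive polar form is
    determined by its values and its polar values on S
    ([polar_additive_segre_eq0]).

    Invariance. A matrix A stabilizing S permutes the points of S and respects
    the relation of lying on a common line of S, which is the relation that
    x + y is 0 or in S. Two points of S are B-orthogonal exactly when some
    point of S is collinear with both ([polarQ2_eq0P]), so A preserves B on S,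
    hence q.

    Uniqueness. A reduced polynomial of degree at most 2 defines a function f
    whose polar form b is additive. If f is invariant under independent
    permutations of the three indices, then take s and t with equal index at
    place a. The line through E t in direction a has two other points, which
    are exchanged by a symmetry fixing E s; as E t is their sum, b (E s) (E t)
    is twice the same value, that is 0. In the same way f (E t) = 0. The pairs
    differing in all places form one orbit, so f is a scalar multiple of q
    ([invariant_form_unique]), and reduced polynomials are determined by their
    values ([squarefree_meval_eq0]).

    The quadric. Each flat defining O_2, and each solid spanned by the
    generators through a point, is spanned by points of S agreeing pairwise in
    some index, so it is totally singular; this gives one inclusion for H_7.
    For the other, every nonzero singular vector is a point of S, or a sum of
    two points of S sharing an index, or the sum of the three neighbours of
    E s obtained by replacing one index at a time by the one of a triple t
    differing from s everywhere. This is a check over the 256 vectors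
    ([singular_bits]). Hyperbolicity is witnessed by one of the flats. *)

Set Implicit Arguments.
Unset Strict Implicit.
Unset Printing Implicit Defensive.

Import GRing.Theory.
Local Open Scope ring_scope.

Local Notation q := (pval Q2).
Local Notation B := (polar (pval Q2)).

(** * Tensor coordinates *)
Lemma F2_split (x : 'F_2) : x = 0 \/ x = 1.
Proof. by case: x => [[|[|n]] h] //; [left|right]; apply/val_inj. Qed.

Lemma F2_add_self (x : 'F_2) : x + x = 0.
Proof. by case: (F2_split x) => ->; apply/val_inj. Qed.

Lemma V8_add_self (v : V8) : v + v = 0.
Proof. by apply/rowP => i; rewrite !mxE F2_add_self. Qed.

Lemma V8_oppr (v : V8) : - v = v.
Proof. by apply/eqP; rewrite eq_sym -addr_eq0 V8_add_self. Qed.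

Lemma I3_split (i : 'I_3) : [\/ i = 0, i = 1 | i = 2].
Proof.
by case: i => [[|[|[|n]]] h] //;
  [apply: Or31 | apply: Or32 | apply: Or33]; apply/val_inj.
Qed.

Definition entry (v : V8) (a b c : 'I_2) : 'F_2 :=
  v 0 (mxtens_index (mxtens_index (a, b), c)).

Definition tens3 (x y z : V2) : V8 := x *t y *t z.

Lemma entryD v w a b c : entry (v + w) a b c = entry v a b c + entry w a b c.
Proof. by rewrite /entry mxE. Qed.

Lemma entry0 a b c : entry 0 a b c = 0.
Proof. by rewrite /entry mxE. Qed.

Lemma entry_tens3 x y z a b c :
  entry (tens3 x y z) a b c = x 0 a * y 0 b * z 0 c.
Proof. by rewrite /entry /tens3 !mxE !mxtens_indexK /= !ord1. Qed.

Lemma entryP (v w : V8) :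
  (forall a b c, entry v a b c = entry w a b c) -> v = w.
Proof.
move=> h; apply/rowP => i; case: (mxtens_indexP i) => j c.
by case: (mxtens_indexP j) => a b; apply: h.
Qed.

(** The coordinates of u_i: since u_2 = u_0 + u_1, both of them are 1 for i = 2. *)
Definition bit (i : 'I_3) (a : 'I_2) : bool := (i == 2) || (i == a :> nat).

Lemma uE i a : u i 0 a = (bit i a)%:R.
Proof.
by case: (I3_split i) => ->; case: a => [[|[|n]] h] //; rewrite /u !mxE; apply/val_inj.
Qed.

Lemma entry_E t a b c :
  entry (E t) a b c =
  (bit (tnth t 0) a)%:R * (bit (tnth t 1) b)%:R * (bit (tnth t 2) c)%:R.
Proof. by rewrite entry_tens3 !uE. Qed.

(** The positions of the entry 1 in e_1, ..., e_8, which are unit vectors of the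
    Kronecker product. *)
Definition digits : 8.-tuple ('I_2 * 'I_2 * 'I_2) :=
  [tuple (0, 0, 0); (1, 0, 0); (1, 1, 0); (0, 1, 0);
         (1, 0, 1); (0, 0, 1); (0, 1, 1); (1, 1, 1)].

Definition entry_at (v : V8) (p : 'I_2 * 'I_2 * 'I_2) : 'F_2 :=
  entry v p.1.1 p.1.2 p.2.

Lemma I2_split (i : 'I_2) : i = 0 \/ i = 1.
Proof. by case: i => [[|[|n]] h] //; [left|right]; apply/val_inj. Qed.

Lemma entry_E3 i j k a b c :
  entry (E [tuple i; j; k]) a b c = (bit i a)%:R * (bit j b)%:R * (bit k c)%:R.
Proof. exact: entry_E. Qed.

Lemma entry_e (i : 'I_8) a b c : entry e`_i a b c = (tnth digits i == (a, b, c))%:R.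
Proof.
case: i => [[|[|[|[|[|[|[|[|n]]]]]]]] lt_i] //=.
all: rewrite entry_E3 -!natrM !mulnb.
all: rewrite (tnth_nth (0,0,0)) /=.
all: by case: (I2_split a) => ->; case: (I2_split b) => ->; case: (I2_split c) => ->.
Qed.

Lemma e_decomposition v : v = \sum_(i < 8) entry_at v (tnth digits i) *: e`_i.
Proof.
apply: entryP => a b c.
have [i0 Ei0] : exists i, (a, b, c) = tnth digits i.
  apply/tnthP.
  by case: (I2_split a) => ->; case: (I2_split b) => ->; case: (I2_split c) => ->.
transitivity (\sum_(i < 8) entry_at v (tnth digits i) * entry e`_i a b c).
  rewrite (bigD1 i0) //= big1 ?entry_e => [|i ne_i].
    by rewrite -Ei0 eqxx mulr1 addr0.
  rewrite entry_e Ei0 (inj_eq _) ?(negPf ne_i) ?mulr0 //.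
  by apply/tuple_uniqP.
rewrite /entry summxE; apply: eq_bigr => i _; by rewrite mxE.
Qed.

Lemma span_e : (<<e>> = fullv)%VS.
Proof.
apply/vspaceP => v; rewrite memvf [v]e_decomposition.
by apply/rpred_sum => i _; apply/rpredZ/memv_span/mem_nth; rewrite size_tuple.
Qed.

Lemma free_e : free e.
Proof. by rewrite /free span_e dimvf size_tuple. Qed.

Lemma coord_e i v : coord e i v = entry_at v (tnth digits i).
Proof. by rewrite {1}[v]e_decomposition coord_sum_free ?free_e. Qed.

Lemma pvalQ2 v :
  q v = entry v 0 0 0 * entry v 1 1 1 + entry v 1 0 0 * entry v 0 1 1
      + entry v 1 1 0 * entry v 0 0 1 + entry v 0 1 0 * entry v 1 0 1.
Proof.
rewrite /pval /Q2 /x_ !mevalD !mevalM !mevalXU !coord_e /entry_at.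
by rewrite !(tnth_nth (0, 0, 0)) !inordK.
Qed.

(** * The polar form of Q_2 on the Segre variety *)

(** The symplectic form of V_2: the 2 by 2 determinant, in characteristic 2. *)
Definition area (x y : V2) : 'F_2 := x 0 0 * y 0 1 + x 0 1 * y 0 0.

(** On a pure tensor the four products of Q_2 are all equal, and 4 = 0. *)
Lemma pvalQ2_tens3 x y z : q (tens3 x y z) = 0.
Proof.
rewrite pvalQ2 !entry_tens3.
set p := x 0 0 * x 0 1 * (y 0 0 * y 0 1) * (z 0 0 * z 0 1).
transitivity ((p + p) + (p + p)); first by rewrite /p; ring.
by rewrite !F2_add_self.
Qed.

(** The eight terms of the expansion of the product of three 2 by 2 determinants
    are the eight terms of the polar form. *)
Lemma polarQ2_tens3 x y z x' y' z' :
  B (tens3 x y z) (tens3 x' y' z') = area x x' * area y y' * area z z'.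
Proof. by rewrite /polar !pvalQ2 !entryD !entry_tens3 /area; ring. Qed.

Lemma area_u i j : area (u i) (u j) = (i != j)%:R.
Proof.
by case: (I3_split i) => ->; case: (I3_split j) => ->; rewrite /area !uE; apply/val_inj.
Qed.

Lemma pvalQ2_E t : q (E t) = 0.
Proof. exact: pvalQ2_tens3. Qed.

Lemma polarQ2_E s t : B (E s) (E t) = [forall a, tnth s a != tnth t a]%:R.
Proof.
rewrite polarQ2_tens3 !area_u -!natrM !mulnb; congr (nat_of_bool _)%:R.
rewrite -andbA; apply/and3P/forallP => [[h0 h1 h2] a | h]; last by split; apply: h.
by case: (I3_split a) => ->.
Qed.

(** * Functions with additive polar form *)

(** Over GF(2) these are the quadratic forms: homogeneity amounts to f 0 = 0,
    which follows ([polar_additive_eval0]). *)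
Definition polar_additive (f : V8 -> 'F_2) :=
  forall x y z, polar f (x + y) z = polar f x z + polar f y z.

Lemma polarC (f : V8 -> 'F_2) x y : polar f x y = polar f y x.
Proof. by rewrite /polar [x + y]addrC addrAC. Qed.

Lemma polarDr f : polar_additive f ->
  forall x y z, polar f x (y + z) = polar f x y + polar f x z.
Proof. by move=> Bf x y z; rewrite polarC Bf !(polarC f x). Qed.

Lemma eval_add (f : V8 -> 'F_2) x y : f (x + y) = f x + f y + polar f x y.
Proof. by rewrite /polar; ring. Qed.

Lemma polar0l f : polar_additive f -> forall y, polar f 0 y = 0.
Proof.
move=> Bf y; have := Bf 0 0 y; rewrite addr0 => /eqP.
by rewrite -subr_eq subrr eq_sym => /eqP.
Qed.

Lemma polar_additive_eval0 f : polar_additive f -> f 0 = 0.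
Proof.
move/polar0l/(_ 0); rewrite /polar addr0 subrr sub0r => /eqP.
by rewrite oppr_eq0 => /eqP.
Qed.

(** Over GF(2) a span consists of the plain sums of its generators. *)
Lemma span_ind (X : seq V8) (K : V8 -> Prop) :
  K 0 -> (forall x y, x \in X -> K y -> K (x + y)) ->
  forall v, v \in <<X>>%VS -> K v.
Proof.
move=> K0; elim: X => [|x X IHX] KX v.
  by rewrite span_nil memv0 => /eqP ->.
rewrite span_cons => /memv_addP[_ /vlineP[k ->] [w Xw ->]].
have Kw : K w.
  by apply: IHX Xw => y z Xy; apply: KX; rewrite inE Xy orbT.
case: (F2_split k) => ->; first by rewrite scale0r add0r.
by rewrite scale1r; apply: KX; rewrite ?mem_head.
Qed.

Lemma segre_ind (K : V8 -> Prop) :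
  K 0 -> (forall t v, K v -> K (E t + v)) -> forall v, K v.
Proof.
move=> K0 KE v.
have e_v : v \in <<e>>%VS by rewrite span_e memvf.
apply: span_ind e_v => // x y.
have -> : tval e = [seq E t | t <- [:: [tuple 0; 0; 0]; [tuple 1; 0; 0];
    [tuple 1; 1; 0]; [tuple 0; 1; 0]; [tuple 1; 0; 1]; [tuple 0; 0; 1];
    [tuple 0; 1; 1]; [tuple 1; 1; 1]]] by [].
by case/mapP => t _ ->; apply: KE.
Qed.

(** Additivity moves the vanishing of the polar form from S to the whole space,
    after which f itself is additive and vanishes on a spanning set. *)
Lemma polar_additive_segre_eq0 f : polar_additive f ->
  (forall t, f (E t) = 0) -> (forall s t, polar f (E s) (E t) = 0) ->
  forall v, f v = 0.
Proof.
move=> Bf fE BE.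
have BEv s : forall v, polar f (E s) v = 0.
  apply: segre_ind => [|t v IH]; first by rewrite polarC polar0l.
  by rewrite polarDr // BE IH addr0.
apply: segre_ind => [|t v IH]; first exact: polar_additive_eval0.
by rewrite eval_add fE IH BEv !addr0.
Qed.

Lemma span_perp f (X : seq V8) z : polar_additive f ->
  {in X, forall x, polar f z x = 0} -> {in <<X>>%VS, forall x, polar f z x = 0}.
Proof.
move=> Bf zX; apply: span_ind => [|x y Xx IH]; first by rewrite polarC polar0l.
by rewrite polarDr // zX ?IH ?addr0.
Qed.

Lemma span_singular f (X : seq V8) : polar_additive f ->
  {in X, forall x, f x = 0} -> {in X &, forall x y, polar f x y = 0} ->
  {in <<X>>%VS, forall x, f x = 0}.
Proof.
move=> Bf fX BX x Xx; have Xk y : y \in X -> polar f y x = 0.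
  by move=> Xy; apply: span_perp Xx => // z; apply: BX.
have [] : f x = 0 /\ {in X, forall y, polar f y x = 0}; last by [].
elim/span_ind: {Xk} x / Xx => [|x y Xx [fy Xy]].
  by split=> [|y _]; [exact: polar_additive_eval0 | rewrite polarC polar0l].
split=> [|z Xz]; first by rewrite eval_add fX ?fy ?Xy ?addr0.
by rewrite polarDr // BX ?Xy ?addr0.
Qed.

Lemma polarQ2 v w : B v w =
    entry v 0 0 0 * entry w 1 1 1 + entry v 1 1 1 * entry w 0 0 0
  + entry v 1 0 0 * entry w 0 1 1 + entry v 0 1 1 * entry w 1 0 0
  + entry v 1 1 0 * entry w 0 0 1 + entry v 0 0 1 * entry w 1 1 0
  + entry v 0 1 0 * entry w 1 0 1 + entry v 1 0 1 * entry w 0 1 0.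
Proof. by rewrite /polar !pvalQ2 !entryD; ring. Qed.

Lemma Q2_polar_additive : polar_additive q.
Proof. by move=> x y z; rewrite !polarQ2 !entryD; ring. Qed.

Lemma Q2_nondegenerate x : (forall y, B x y = 0) -> x = 0.
Proof.
move=> Bx; apply: entryP => a b c; rewrite entry0.
(* The basis point opposite to position (a, b, c) reads off that entry. *)
have := Bx (E [tuple (if a == 0 then 1 else 0); (if b == 0 then 1 else 0);
                     (if c == 0 then 1 else 0)]).
rewrite polarQ2 !entry_E3 => <-.
by case: (I2_split a) => ->; case: (I2_split b) => ->; case: (I2_split c) => ->;
  rewrite /bit /= ?(mulr0, mulr1, addr0, add0r).
Qed.

(** * Index triples and lines of the Segre variety *)

(** The indices 0, 1, 2 sum to 0 modulo 3, so this is the third index when i and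
    j are distinct. *)
Definition third (i j : 'I_3) : 'I_3 := - (i + j).
Definition avoid (i j : 'I_3) : 'I_3 := if i == j then i + 1 else third i j.

Lemma avoidP i j : avoid i j != i /\ avoid i j != j.
Proof. by case: (I3_split i) => ->; case: (I3_split j) => ->. Qed.

Lemma uD i j : i != j -> u i + u j = u (third i j).
Proof.
move=> ne_ij; apply/rowP => a; rewrite mxE !uE; move: ne_ij.
by case: (I3_split i) => ->; case: (I3_split j) => -> // _;
  case: (I2_split a) => ->; apply/val_inj.
Qed.

Definition upd (t : 3.-tuple 'I_3) (a x : 'I_3) : 3.-tuple 'I_3 :=
  [tuple if b == a then x else tnth t b | b < 3].

Definition agree_off (a : 'I_3) (s t : 3.-tuple 'I_3) : bool :=
  [forall b, (b != a) ==> (tnth s b == tnth t b)].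

Lemma agree_offP a s t :
  reflect (forall b, b != a -> tnth s b = tnth t b) (agree_off a s t).
Proof.
by apply: (iffP forallP) => h b; [move/(implyP (h b))/eqP | apply/implyP => /h/eqP].
Qed.

Lemma tnth_upd t a x b : tnth (upd t a x) b = if b == a then x else tnth t b.
Proof. by rewrite tnth_mktuple. Qed.

(** In direction a the tensor is linear, and u_i + u_j is the third vector u_k. *)
Lemma E_line a s t : agree_off a s t -> tnth s a != tnth t a ->
  E s + E t = E (upd s a (third (tnth s a) (tnth t a))).
Proof.
move=> /agree_offP st ne_a.
apply: entryP => i j k; rewrite entryD !entry_tens3 !tnth_upd.
case: (I3_split a) st ne_a => -> st ne_a /=; rewrite -(uD ne_a) mxE.
- by rewrite (st 1) ?(st 2) //; ring.
- by rewrite (st 0) ?(st 2) //; ring.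
- by rewrite (st 0) ?(st 1) //; ring.
Qed.

Lemma polarQ2_E_agree a s t : tnth s a = tnth t a -> B (E s) (E t) = 0.
Proof.
move=> st; rewrite polarQ2_E; case: forallP => // /(_ a).
by rewrite st eqxx.
Qed.

Lemma polarQ2_E_opposite s t :
  (forall a, tnth s a != tnth t a) -> B (E s) (E t) = 1.
Proof. by move=> st; rewrite polarQ2_E; case: forallP. Qed.

(** If s and t differ at a, then a triple z equal to s at a and different from t
    everywhere has E z orthogonal to E s but not to E t. *)
Lemma E_inj : injective E.
Proof.
move=> s t Est; apply: eq_from_tnth => a; apply/eqP/negPn/negP => ne_a.
pose z := upd [tuple avoid (tnth s b) (tnth t b) | b < 3] a (tnth s a).
have: B (E z) (E t) = 1.
  apply: polarQ2_E_opposite => b; rewrite tnth_upd.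
  by case: (eqVneq b a) => [-> // | _]; rewrite tnth_mktuple; case: (avoidP (tnth s b) (tnth t b)).
by rewrite -Est (@polarQ2_E_agree a) // tnth_upd eqxx.
Qed.

Lemma E_neq0 t : E t != 0.
Proof.
apply/eqP => Et0.
have := @polarQ2_E_opposite t [tuple avoid (tnth t b) (tnth t b) | b < 3].
rewrite Et0 (polar0l Q2_polar_additive) => /(_ _)/eqP; rewrite eq_sym oner_eq0 => h.
suff: false by []; apply: h => b; rewrite tnth_mktuple eq_sym.
by case: (avoidP (tnth t b) (tnth t b)).
Qed.

(** Pairing E s + E r = E w with suitable points E z excludes the unwanted values
    of w; the key step in showing that such a sum lies on a line of S. *)
Lemma line_third a b s r w : E s + E r = E w ->
  tnth s a != tnth r a -> b != a -> tnth w b = tnth r b.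
Proof.
move=> Ew ne_a ne_ba.
have Bw z : B (E z) (E w) = B (E z) (E s) + B (E z) (E r).
  by rewrite -Ew (polarDr Q2_polar_additive).
(* Otherwise z, agreeing with s and w at a, would see E r alone. *)
have w_a : tnth s a != tnth w a.
  apply/eqP => sw.
  pose z := upd [tuple avoid (tnth r c) (tnth r c) | c < 3] a (tnth s a).
  have := Bw z; rewrite (@polarQ2_E_agree a z s) ?(@polarQ2_E_agree a z w) ?tnth_upd ?eqxx //.
  rewrite polarQ2_E_opposite // => c; rewrite tnth_upd.
  case: (eqVneq c a) => [-> // | _]; rewrite tnth_mktuple.
  by case: (avoidP (tnth r c) (tnth r c)).
(* z is orthogonal to E s by its index at a and to E r by its index at b. *)
apply/eqP/negPn/negP => ne_b.
pose z := upd (upd [tuple avoid (tnth w c) (tnth w c) | c < 3] b (tnth r b)) a (tnth s a).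
have := Bw z; rewrite (@polarQ2_E_agree a z s) ?tnth_upd ?eqxx //.
rewrite (@polarQ2_E_agree b z r) ?tnth_upd ?(negPf ne_ba) ?tnth_upd ?eqxx //.
rewrite polarQ2_E_opposite // => c; rewrite !tnth_upd.
case: (eqVneq c a) => [-> // | _]; case: (eqVneq c b) => [-> | _]; first by rewrite eq_sym.
by rewrite tnth_mktuple; case: (avoidP (tnth w c) (tnth w c)).
Qed.

(** If s and t differed at two places a and b, [line_third] applied at a and at b
    would make the third point w equal to t, whence E s = 0. *)
Lemma collinearP s t :
  reflect (exists a, agree_off a s t) (E s + E t \in 0 |: segre).
Proof.
apply: (iffP idP) => [|[a st]]; last first.
  have [st_a | ne_a] := eqVneq (tnth s a) (tnth t a).
    have -> : s = t.
      apply: eq_from_tnth => b.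
      by have [-> // | /(agree_offP _ _ _ st)] := eqVneq b a.
    by rewrite V8_add_self setU11.
  by rewrite (E_line st ne_a) inE imset_f ?orbT.
have refl_st : s = t -> exists a, agree_off a s t.
  by move=> ->; exists 0; apply/agree_offP.
case/setU1P => [/eqP|/imsetP[w _ Ew]].
  by rewrite addr_eq0 V8_oppr => /eqP/E_inj.
have [// | ne_st] := eqVneq s t.
have [a ne_a] : exists a, tnth s a != tnth t a.
  apply/existsP; apply: contraT => /existsPn st.
  by case/eqP: ne_st; apply: eq_from_tnth => a; apply/eqP/negPn/st.
exists a; apply/agree_offP => b ne_ba; apply/eqP/negPn/negP => ne_b.
have wt : w = t.
  apply: eq_from_tnth => c; have [-> | ] := eqVneq c a.
    by apply: (line_third Ew ne_b); rewrite eq_sym.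
  exact: (line_third Ew ne_a).
by move/eqP: Ew; rewrite wt -[X in _ == X]add0r (inj_eq (addIr _)) (negPf (E_neq0 s)).
Qed.

Lemma third_index (a b : 'I_3) : exists c, (c != a) && (c != b).
Proof. by exists (avoid a b); case: (avoidP a b) => -> ->. Qed.

(** Orthogonality on S in terms of S alone, so that any stabilizer of S preserves
    it. A point collinear with both E s and E t changes s at one place and t at
    one place, leaving a place where s and t agree; conversely, if they agree at
    c, changing s at another place a to the index of t leaves at most the third
    place where it differs from t. *)
Lemma polarQ2_eq0P s t :
  reflect (exists2 r, E s + E r \in 0 |: segre & E t + E r \in 0 |: segre)
          (B (E s) (E t) == 0).
Proof.
apply: (iffP eqP) => [Bst | [r /collinearP[a sr] /collinearP[b tr]]].
  have [c st_c] : exists c, tnth s c == tnth t c.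
    apply/existsP; apply: contraT => /existsPn st.
    by have := polarQ2_E_opposite st; rewrite Bst.
  have [a /andP[ne_ac _]] := third_index c c.
  exists (upd s a (tnth t a)); apply/collinearP.
    by exists a; apply/agree_offP => b /negPf ne_ba; rewrite tnth_upd ne_ba.
  (* third a c is the place other than a and c. *)
  exists (third a c); apply/agree_offP => b; rewrite tnth_upd.
  have [-> // | ne_ba ne_b] := eqVneq b a; suff -> : b = c by rewrite -(eqP st_c).
  move: ne_ac ne_ba ne_b.
  by case: (I3_split a) => ->; case: (I3_split b) => ->; case: (I3_split c) => ->.
have [c /andP[ne_ca ne_cb]] := third_index a b.
by apply: (@polarQ2_E_agree c); rewrite (agree_offP _ _ _ sr) // (agree_offP _ _ _ tr).
Qed.

(** * Invariance of Q_2 *)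
Lemma GS_unit A : A \in GS -> A \in unitmx.
Proof. by rewrite inE => /andP[]. Qed.

Lemma GS_segre A x : A \in GS -> (x *m A \in segre) = (x \in segre).
Proof.
rewrite inE => /andP[unitA /eqP segreA]; rewrite -[in LHS]segreA.
by apply: mem_imset; apply: can_inj (mulmxK unitA).
Qed.

Lemma GS_inv A : A \in GS -> invmx A \in GS.
Proof.
move=> GA; have uA := GS_unit GA.
rewrite inE unitmx_inv uA /=; apply/eqP/setP => x; rewrite -(GS_segre x GA).
by rewrite -{1}[x](mulmxK uA); apply: mem_imset; apply: can_inj (mulmxKV uA).
Qed.

Lemma GS_collinear A x : A \in GS -> (x *m A \in 0 |: segre) = (x \in 0 |: segre).
Proof.
move=> GA; rewrite !inE GS_segre //; congr (_ || _).
by rewrite -[in RHS](inj_eq (can_inj (mulmxK (GS_unit GA)))) mul0mx.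
Qed.

Lemma GS_E A t : A \in GS -> exists s, E t *m A = E s.
Proof.
move=> GA; have: E t *m A \in segre by rewrite GS_segre // imset_f.
by case/imsetP => s _ ->; exists s.
Qed.

Lemma polar_mulmx (f : V8 -> 'F_2) (A : 'M_(2 * 2 * 2)) x y :
  polar (fun v => f (v *m A)) x y = polar f (x *m A) (y *m A).
Proof. by rewrite /polar mulmxDl. Qed.

Lemma polarB f g x y :
  polar (fun v : V8 => f v - g v : 'F_2) x y = polar f x y - polar g x y.
Proof. by rewrite /polar; ring. Qed.

Lemma polar_additiveB f g :
  polar_additive f -> polar_additive g -> polar_additive (fun v => f v - g v).
Proof. by move=> Bf Bg x y z; rewrite !polarB Bf Bg; ring. Qed.

Lemma polar_additive_mulmx f (A : 'M_(2 * 2 * 2)) :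
  polar_additive f -> polar_additive (fun v => f (v *m A)).
Proof. by move=> Bf x y z; rewrite !polar_mulmx mulmxDl Bf. Qed.

Lemma F2_eq0_inj (x y : 'F_2) : (x == 0) = (y == 0) -> x = y.
Proof. by case: (F2_split x) => ->; case: (F2_split y) => ->. Qed.

(** The difference of q and its transform vanishes on S together with its polar
    form: over GF(2) it suffices that the polar values vanish simultaneously. *)
Lemma Q2_invariant : GS_invariant Q2.
Proof.
move=> A GA v; apply/eqP; rewrite -subr_eq0; apply/eqP; move: v.
apply: (polar_additive_segre_eq0 (f := fun v => q (v *m A) - q v)).
- by apply/polar_additiveB/Q2_polar_additive/polar_additive_mulmx/Q2_polar_additive.
- by move=> t; have [t' ->] := GS_E t GA; rewrite !pvalQ2_E subrr.
move=> s t; rewrite polarB polar_mulmx; apply/eqP; rewrite subr_eq0; apply/eqP.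
have [s' Es] := GS_E s GA; have [t' Et] := GS_E t GA; rewrite Es Et.
apply: F2_eq0_inj; apply/polarQ2_eq0P/polarQ2_eq0P => -[r].
  have [r' Er] := GS_E r (GS_inv GA).
  have {}Er : E r = E r' *m A by rewrite -Er mulmxKV ?GS_unit.
  by rewrite -Es -Et Er -!mulmxDl !GS_collinear //; exists r'.
have [r' Er] := GS_E r GA => sr tr.
by exists r'; rewrite -?Es -?Et -Er -mulmxDl GS_collinear.
Qed.

(** * Permuting the indices at each place *)

(** GL(V_2) acts on u_0, u_1, u_2 as the full symmetric group; this is the matrix
    realizing p, whose rows are the images of u_0 and u_1. *)
Definition perm_V2 (p : {perm 'I_3}) : 'M['F_2]_2 :=
  \matrix_(i, j) u (p (if i == 0 then 0 else 1)) 0 j.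

Lemma u_perm_V2 p i : u i *m perm_V2 p = u (p i).
Proof.
apply/rowP => j; rewrite !mxE !big_ord_recl big_ord0 addr0 !mxE !uE /=.
have p012 : u (p 2) 0 j = u (p 0) 0 j + u (p 1) 0 j.
  transitivity ((u (p 0) + u (p 1)) 0 j); last by rewrite mxE.
  rewrite uD ?(inj_eq perm_inj) //; congr (u _ 0 j).
  have := inj_eq (@perm_inj _ p) 0 1; have := inj_eq (@perm_inj _ p) 0 2.
  have := inj_eq (@perm_inj _ p) 1 2.
  case: (I3_split (p 0)) => ->; case: (I3_split (p 1)) => ->;
     case: (I3_split (p 2)) => -> // *; apply/val_inj => //.
case: (I3_split i) => -> /=; rewrite -?uE ?p012 /bit /=.
- by rewrite mul1r mul0r addr0.
- by rewrite mul1r mul0r add0r.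
- by rewrite !mul1r.
Qed.

(** The inverse permutation gives the inverse matrix. *)
Lemma perm_V2_unit p : perm_V2 p \in unitmx.
Proof.
have pV : perm_V2 p *m perm_V2 p^-1%g = 1%:M; last exact: proj1 (mulmx1_unit pV).
apply/row_matrixP => i; rewrite row1 row_mul rowE.
have -> : delta_mx 0 i = u (if i == 0 then 0 else 1) :> V2.
  by case: (I2_split i) => ->.
by rewrite u_perm_V2 u_perm_V2 permK.
Qed.

Definition perm_V8 (p : 'I_3 -> {perm 'I_3}) : 'M['F_2]_(2 * 2 * 2) :=
  perm_V2 (p 0) *t perm_V2 (p 1) *t perm_V2 (p 2).

Definition act (p : 'I_3 -> {perm 'I_3}) (t : 3.-tuple 'I_3) : 3.-tuple 'I_3 :=
  [tuple p a (tnth t a) | a < 3].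

Lemma tnth_act p t a : tnth (act p t) a = p a (tnth t a).
Proof. exact: tnth_mktuple. Qed.

Lemma tens3_mulmx x y z (M N P : 'M['F_2]_2) :
  tens3 x y z *m (M *t N *t P) = tens3 (x *m M) (y *m N) (z *m P).
Proof.
rewrite /tens3 -(tensmx_mul x y M N).
exact: (tensmx_mul (x *t y) z (M *t N) P).
Qed.

Lemma E_perm_V8 p t : E t *m perm_V8 p = E (act p t).
Proof. by rewrite tens3_mulmx !u_perm_V2 /E !tnth_act. Qed.

Lemma perm_V8_GS p : perm_V8 p \in GS.
Proof.
have uA : perm_V8 p \in unitmx by rewrite !tensmx_unit ?perm_V2_unit.
rewrite inE uA eqEcard (card_imset _ (can_inj (mulmxK uA))) leqnn andbT.
by apply/subsetP => _ /imsetP[_ /imsetP[t _ ->] ->]; rewrite E_perm_V8 imset_f.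
Qed.

(** * Invariant quadratic forms *)
Section InvariantForm.
Variable f : V8 -> 'F_2.
Hypothesis f_polar_additive : polar_additive f.
Hypothesis f_invariant : forall A, A \in GS -> forall v, f (v *m A) = f v.

Lemma invariant_E p t : f (E (act p t)) = f (E t).
Proof. by rewrite -E_perm_V8 f_invariant ?perm_V8_GS. Qed.

Lemma invariant_polar_E p s t :
  polar f (E (act p s)) (E (act p t)) = polar f (E s) (E t).
Proof. by rewrite -!E_perm_V8 /polar -mulmxDl !f_invariant ?perm_V8_GS. Qed.

(** The symmetry exchanging, at place a only, the two indices other than x. *)
Definition swap (a x : 'I_3) (b : 'I_3) : {perm 'I_3} :=
  if b == a then tperm (x + 1) (x + 2) else 1%g.

Lemma swap_fix a s : act (swap a (tnth s a)) s = s.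
Proof.
apply: eq_from_tnth => b; rewrite tnth_act /swap.
have [-> | _] := eqVneq b a; last by rewrite perm1.
by rewrite tpermD //; case: (I3_split (tnth s a)) => ->.
Qed.

Lemma swap_upd a x t :
  act (swap a x) (upd t a (x + 1)) = upd t a (x + 2).
Proof.
apply: eq_from_tnth => b; rewrite tnth_act !tnth_upd /swap.
by case: eqP => _; rewrite ?perm1 ?tpermL.
Qed.

Lemma line_through a t :
  E (upd t a (tnth t a + 1)) + E (upd t a (tnth t a + 2)) = E t.
Proof.
rewrite (@E_line a); first congr E; last first.
- by rewrite !tnth_upd eqxx; case: (I3_split (tnth t a)) => ->.
- by apply/agree_offP => b /negPf ne_ba; rewrite !tnth_upd ne_ba.
apply: eq_from_tnth => b; rewrite !tnth_upd eqxx.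
have [-> | //] := eqVneq b a; apply/val_inj.
by case: (I3_split (tnth t a)) => ->.
Qed.

(** E t is the sum of the two other points on its line in direction a, and these
    are exchanged by a symmetry that fixes E s. *)
Lemma invariant_polar_agree a s t :
  tnth s a = tnth t a -> polar f (E s) (E t) = 0.
Proof.
move=> st; rewrite -(line_through a t) polarDr //.
rewrite -(invariant_polar_E (swap a (tnth t a)) s (upd t a _)).
by rewrite swap_upd -{1}st swap_fix F2_add_self.
Qed.

(** The same decomposition: the two summands take equal values and, agreeing in
    an index, are orthogonal. *)
Lemma invariant_E_eq0 t : f (E t) = 0.
Proof.
rewrite -(line_through 0 t) eval_add (@invariant_polar_agree 1) ?tnth_upd // addr0.
by rewrite -(invariant_E (swap 0 (tnth t 0))) swap_upd F2_add_self.
Qed.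

Lemma invariant_polar_opposite s t : (forall a, tnth s a != tnth t a) ->
  polar f (E s) (E t) = polar f (E [tuple 0; 0; 0]) (E [tuple 1; 1; 1]).
Proof.
move=> st.
(* At each place, p sends 0 to the index of s and 1 to that of t. *)
pose p a : {perm 'I_3} :=
  (tperm 0 (tnth s a) * tperm (tperm 0 (tnth s a) 1%R) (tnth t a))%g.
rewrite -[RHS](invariant_polar_E p); congr (polar f (E _) (E _)).
  apply: eq_from_tnth => a; apply/esym; rewrite tnth_act permM.
  have -> : tnth [tuple 0; 0; 0] a = 0 :> 'I_3 by case: (I3_split a) => ->.
  have ne1 : tperm 0 (tnth s a) 1 != tnth s a.
    by rewrite -[X in _ != X](tpermL 0) (inj_eq perm_inj).
  by rewrite tpermL (tpermD ne1) // eq_sym.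
apply: eq_from_tnth => a; apply/esym; rewrite tnth_act permM.
have -> : tnth [tuple 1; 1; 1] a = 1 :> 'I_3 by case: (I3_split a) => ->.
by rewrite tpermL.
Qed.

Lemma invariant_form_unique : exists k, forall v, f v = k * q v.
Proof.
pose k := polar f (E [tuple 0; 0; 0]) (E [tuple 1; 1; 1]); exists k => v.
apply/eqP; rewrite -subr_eq0; apply/eqP; move: v.
have polark x y : polar (fun v => k * q v) x y = k * B x y.
  by rewrite /polar; ring.
apply: (polar_additive_segre_eq0 (f := fun v => f v - k * q v)).
- apply: polar_additiveB f_polar_additive _ => x y z.
  by rewrite !polark Q2_polar_additive mulrDr.
- by move=> t; rewrite invariant_E_eq0 pvalQ2_E mulr0 subr0.
move=> s t; rewrite polarB polark.
have [/existsP[a /eqP st] | /existsPn st] := boolP [exists a, tnth s a == tnth t a].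
  by rewrite (invariant_polar_agree st) (polarQ2_E_agree st) mulr0 subr0.
by rewrite invariant_polar_opposite // polarQ2_E_opposite // mulr1 subrr.
Qed.
End InvariantForm.

(** * Polynomials as functions *)

(** Evaluate at the indicator vector of a squarefree monomial m: the surviving
    monomials divide m, and by induction on the degree only m itself has a
    coefficient that may be nonzero. *)
Lemma squarefree_meval_eq0 (R : comNzRingType) (n : nat) (P : {mpoly R[n]}) :
  (forall m, m \in msupp P -> forall i, (m i <= 1)%N) ->
  (forall v, P.@[v] = 0) -> P = 0.
Proof.
move=> sqf P0; apply/mpolyP => m; rewrite mcoeff0.
have [d] := ubnP (mdeg m); elim: d m => // d IHd m le_m_d.
have [Pm|/memN_msupp_eq0//] := boolP (m \in msupp P).
have := P0 (fun i => (m i)%:R); rewrite mevalE (bigD1_seq m) ?msupp_uniq //=.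
rewrite [X in _ + X]big1_seq => [|m' /andP[ne_m' Pm']].
  rewrite addr0 big1 ?mulr1 // => i _.
  by case: (m i) (sqf m Pm i) => [|[]] //; rewrite expr1n.
have [le_m' | ] := boolP (m' <= m)%MM.
  suff lt_m' : (mdeg m' < mdeg m)%N by rewrite IHd ?mul0r // (leq_trans lt_m').
  rewrite -(submK le_m') mdegD addnC -[ltnLHS]addn0 ltn_add2l lt0n mdeg_eq0.
  apply: contra ne_m' => /eqP m0; by rewrite -(submK le_m') m0 add0m.
case/forallPn => i; rewrite -ltnNge => lt_mi.
have m0 : m i = 0%N by case: (m i) lt_mi => // k; rewrite ltnNge (leq_trans (sqf m' Pm' i)).
rewrite (bigD1 i) //= m0 expr0n; case: (m' i) lt_mi => [|k]; rewrite ?m0 //= => _.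
by rewrite mul0r mulr0.
Qed.

Lemma pval_injective P Q : reduced P -> reduced Q ->
  (forall v, pval P v = pval Q v) -> P = Q.
Proof.
move=> redP redQ PQ; apply/eqP; rewrite -subr_eq0; apply/eqP.
apply: squarefree_meval_eq0 => [m|v].
  by move/msuppB_le; rewrite mem_cat => /orP[/redP[] | /redQ[]].
rewrite mevalB; have := PQ (\sum_(i < 8) v i *: e`_i); rewrite /pval.
have coord_v : (fun i => coord e i (\sum_(i < 8) v i *: e`_i)) =1 v.
  by move=> i; rewrite coord_sum_free ?free_e.
by rewrite !(meval_eq _ coord_v) => ->; rewrite subrr.
Qed.

Lemma polar_additiveD f g :
  polar_additive f -> polar_additive g -> polar_additive (fun v => f v + g v).
Proof.
move=> Bf Bg x y z.
have polarD x' y' : polar (fun v => f v + g v) x' y' = polar f x' y' + polar g x' y'.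
  by rewrite /polar; ring.
by rewrite !polarD Bf Bg; ring.
Qed.

Lemma polar_additiveZ k f : polar_additive f -> polar_additive (fun v => k * f v).
Proof.
move=> Bf x y z.
have polarZ x' y' : polar (fun v => k * f v) x' y' = k * polar f x' y'.
  by rewrite /polar; ring.
by rewrite !polarZ Bf; ring.
Qed.

Lemma polar_additive_ext f g : f =1 g -> polar_additive f -> polar_additive g.
Proof. by move=> fg Bf x y z; have := Bf x y z; rewrite /polar !fg. Qed.

(** Such a monomial is x_i, with zero polar form, or x_i x_j, with polar form
    x_i y_j + x_j y_i. *)
Lemma pval_monomial_polar_additive m :
  m != 0%MM -> (mdeg m <= 2)%N -> polar_additive (pval 'X_[m]).
Proof.
move=> m0 m2.
have [i mi] : exists i, m i != 0%N.
  apply/existsP; apply: contraNT m0 => /existsPn mi.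
  by apply/eqP/mnmP => i; rewrite mnm0E; apply/eqP/negPn/mi.
have le_im : (U_(i) <= m)%MM by rewrite lep1mP.
have Em := submK le_im; move: m2; rewrite -Em mdegD mdeg1 addn1 ltnS.
rewrite /pval mpolyXD leq_eqVlt ltnS leqn0 mdeg_eq0 mdeg_eq1.
case/orP => [/existsP[j /eqP ->] | /eqP ->] x y z.
  by rewrite /polar !mevalM !mevalXU !linearD /=; ring.
by rewrite mpolyX0 mul1r /polar !mevalXU !linearD /=; ring.
Qed.

Lemma pval_polar_additive P :
  reduced P -> (pdegree P <= 2)%N -> polar_additive (pval P).
Proof.
move=> redP degP.
pose f (r : seq 'X_{1..8}) v := \sum_(m <- r) P@_m * pval 'X_[m] v.
apply: (@polar_additive_ext (f (msupp P))) => [v|].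
  by rewrite /f /pval mevalE; apply: eq_bigr => m _; rewrite mevalX.
have : {subset msupp P <= msupp P} by [].
elim: {1 3}(msupp P) => [|m r IHr] sub_r.
  apply: (@polar_additive_ext (fun _ => 0)) => [v | x y z]; last by rewrite /polar; ring.
  by rewrite /f big_nil.
apply: (@polar_additive_ext (fun v => P@_m * pval 'X_[m] v + f r v)) => [v|].
  by rewrite /f big_cons.
have Pm : m \in msupp P by apply: sub_r; rewrite mem_head.
apply: polar_additiveD; last by apply: IHr => m' r_m'; apply: sub_r; rewrite inE r_m' orbT.
apply: polar_additiveZ; apply: pval_monomial_polar_additive; first by case: (redP m Pm) => /eqP.
by rewrite -ltnS (leq_trans (msize_mdeg_lt Pm)) // (leq_trans (leqSpred _)).
Qed.

(** Indices count from 0, so the pairs 1-8, 2-7, 3-6, 4-5 become k and 7 - k. *)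
Definition Q2_monomial (k : nat) : 'X_{1..8} :=
  (U_(inord k) + U_(inord (7 - k)))%MM.

Lemma Q2E : Q2 = \sum_(k < 4) 'X_[Q2_monomial k].
Proof. by rewrite !big_ord_recl big_ord0 addr0 /= !addrA /Q2_monomial !mpolyXD. Qed.

Lemma msupp_Q2 m : m \in msupp Q2 -> exists2 k, (k < 4)%N & m = Q2_monomial k.
Proof.
rewrite Q2E mcoeff_msupp raddf_sum /= => Qm.
have /existsP[k /eqP <-] : [exists k : 'I_4, Q2_monomial k == m].
  apply: contraNT Qm => /existsPn nk; apply/eqP; apply: big1 => k _.
  by rewrite mcoeffX (negPf (nk k)).
by exists k.
Qed.

Lemma Q2_reduced : reduced Q2.
Proof.
move=> m /msupp_Q2[k lt_k ->]; split=> [/(congr1 mdeg) | i].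
  by rewrite mdegD !mdeg1 mdeg0.
rewrite mnmDE !mnm1E; case: eqP => [<- | _]; last by case: eqP.
by case: eqP => // /(congr1 val); rewrite /= !inordK //; case: k lt_k => [|[|[|[]]]].
Qed.

Lemma Q2_neq0 : Q2 != 0.
Proof.
apply/eqP => Q0; have := polarQ2_E_opposite (s := [tuple 0; 0; 0]) (t := [tuple 1; 1; 1]).
rewrite Q0 /polar /pval !meval0 !subr0 => /(_ _)/esym/eqP; rewrite oner_eq0 => h.
suff: false by []; by apply: h => a; case: (I3_split a) => ->.
Qed.

Lemma Q2_degree : pdegree Q2 = 2%N.
Proof.
rewrite /pdegree -(mlead_deg Q2_neq0).
by have [k _ ->] := msupp_Q2 (mlead_supp Q2_neq0); rewrite mdegD !mdeg1.
Qed.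

Lemma Q2_unique P :
  [/\ reduced P, pdegree P = 2%N & GS_invariant P] <-> P = Q2.
Proof.
split=> [[redP degP invP] | ->]; last first.
  by split; [exact: Q2_reduced | exact: Q2_degree | exact: Q2_invariant].
have Bf : polar_additive (pval P) by apply: pval_polar_additive; rewrite ?degP.
have [k kP] := invariant_form_unique Bf invP.
case: (F2_split k) kP => -> kP.
  have P0 : P = 0.
    apply: pval_injective => // [m | v]; first by rewrite msupp0.
    by rewrite kP mul0r /pval meval0.
  by rewrite P0 /pdegree msize0 in degP.
apply: pval_injective => // [|v]; first exact: Q2_reduced.
by rewrite kP mul1r.
Qed.

(** * Classification of the singular vectors *)

(** Indices and entries are recoded by booleans so that the check over all
    vectors of V_8 is a fast computation: Some false, Some true and None stand
    for the indices 0, 1 and 2. *)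
Definition ord2 (b : bool) : 'I_2 := if b then 1 else 0.

Definition ord3 (i : option bool) : 'I_3 :=
  if i is Some b then (if b then 1 else 0) else 2.

Definition label := (option bool * option bool * option bool)%type.

Definition point (s : label) : V8 := E [tuple ord3 s.1.1; ord3 s.1.2; ord3 s.2].

Definition corners : seq (bool * bool * bool) :=
  [:: (false, false, false); (false, false, true); (false, true, false);
      (false, true, true); (true, false, false); (true, false, true);
      (true, true, false); (true, true, true)].

Definition entry_bit (v : V8) (p : bool * bool * bool) : bool :=
  entry v (ord2 p.1.1) (ord2 p.1.2) (ord2 p.2) != 0.

Definition bits (v : V8) : seq bool := [seq entry_bit v p | p <- corners].

Definition xor_bits (k l : seq bool) : seq bool :=
  [seq p.1 (+) p.2 | p <- zip k l].

Definition u_bit (i : option bool) (a : bool) : bool :=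
  if i is Some b then b == a else true.

Definition point_bits (s : label) : seq bool :=
  [seq [&& u_bit s.1.1 p.1.1, u_bit s.1.2 p.1.2 & u_bit s.2 p.2] | p <- corners].

Lemma bits_inj : injective bits.
Proof.
move=> v w /eq_in_map vw; apply: entryP => a b c; apply: F2_eq0_inj.
have ord2K (i : 'I_2) : i = ord2 (i == 1) by case: (I2_split i) => ->.
rewrite [a]ord2K [b]ord2K [c]ord2K.
apply/negb_inj/(vw (a == 1, b == 1, c == 1)).
by case: (a == 1); case: (b == 1); case: (c == 1).
Qed.

Lemma bitsD v w : bits (v + w) = xor_bits (bits v) (bits w).
Proof.
have addE p : entry_bit (v + w) p = entry_bit v p (+) entry_bit w p.
  rewrite /entry_bit entryD.
  case: (F2_split (entry v (ord2 p.1.1) (ord2 p.1.2) (ord2 p.2))) => ->;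
  by case: (F2_split (entry w (ord2 p.1.1) (ord2 p.1.2) (ord2 p.2))) => ->.
by rewrite /bits /xor_bits /= !addE.
Qed.

Lemma bits_point s : bits (point s) = point_bits s.
Proof.
have bitE i a : bit (ord3 i) (ord2 a) = u_bit i a by case: i => [[]|]; case: a.
rewrite /bits /point_bits; apply: eq_map => p; rewrite /entry_bit entry_E3 !bitE.
by case: (u_bit _ _); case: (u_bit _ _); case: (u_bit _ _).
Qed.

Definition labels : seq label :=
  let r := [:: Some false; Some true; None] in
  [seq (ij, k) | ij <- [seq (i, j) | i <- r, j <- r], k <- r].

(** In the last case s and t differ everywhere, and the sum is that of
    [tangent_point] below. *)
Definition bits_pattern (l : seq bool) (s t : label) : bool :=
  if l == point_bits s then true else
  if [|| s.1.1 == t.1.1, s.1.2 == t.1.2 | s.2 == t.2]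
  then l == xor_bits (point_bits s) (point_bits t)
  else l == xor_bits (xor_bits (point_bits (t.1.1, s.1.2, s.2))
                               (point_bits (s.1.1, t.1.2, s.2)))
                      (point_bits (s.1.1, s.1.2, t.2)).

Fixpoint all_bits (n : nat) (p : pred (seq bool)) : bool :=
  if n is n'.+1
  then all_bits n' (fun l => p (true :: l)) && all_bits n' (fun l => p (false :: l))
  else p [::].

Lemma all_bitsP n p l : all_bits n p -> size l = n -> p l.
Proof.
elim: n p l => [|n IHn] p [|b l] //= /andP[pT pF] [sz_l].
by case: b; [apply: (IHn (fun l => p (true :: l)))
            | apply: (IHn (fun l => p (false :: l)))].
Qed.

(** The positions refer to the lexicographic order of [corners], which differs from
    the order of the basis e. *)
Definition Q2_bits (l : seq bool) : bool :=
  let x := nth false l in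
  (x 0 && x 7) (+) (x 4 && x 3) (+) (x 6 && x 1) (+) (x 2 && x 5).

Lemma bits_Q2 v : Q2_bits (bits v) = (q v != 0).
Proof.
have mulE (x y : 'F_2) : (x != 0) && (y != 0) = (x * y != 0).
  by rewrite mulf_eq0 negb_or.
have addE (x y : 'F_2) : (x != 0) (+) (y != 0) = (x + y != 0).
  by case: (F2_split x) => ->; case: (F2_split y) => ->.
by rewrite /Q2_bits /bits /= /entry_bit !mulE !addE pvalQ2.
Qed.

Lemma singular_bits :
  all_bits 8 (fun l =>
    if has id l && ~~ Q2_bits l
    then has (fun s => has (bits_pattern l s) labels) labels else true).
Proof. by vm_compute. Qed.

(** As t varies over the eight triples differing everywhere from s, these are the
    two points completing E s to its distinguished tangent. *)
Definition tangent_point (s t : 3.-tuple 'I_3) : V8 :=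
  \sum_(a < 3) E (upd s a (tnth t a)).

Lemma singular_cases v : v != 0 -> q v = 0 ->
  exists s t, [\/ v = E s, (exists2 a, tnth s a = tnth t a & v = E s + E t)
    | (forall a, tnth s a != tnth t a) /\ v = tangent_point s t].
Proof.
move=> v0 qv.
have v_bits : has id (bits v).
  apply: contraNT v0 => /hasPn no_bit; apply/eqP/bits_inj.
  have -> : bits 0 = nseq (size (bits v)) false by rewrite /bits /entry_bit /= !entry0.
  by apply/all_pred1P/allP => -[] // /no_bit.
have /hasP[s _ /hasP[t _]] :
    has (fun s => has (bits_pattern (bits v) s) labels) labels.
  have := @all_bitsP 8 _ (bits v) singular_bits (erefl _).
  by rewrite v_bits bits_Q2 qv eqxx.
rewrite /bits_pattern.
pose tup (s : label) := [tuple ord3 s.1.1; ord3 s.1.2; ord3 s.2].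
case: (bits v =P point_bits s) => [vs _ | _].
  by exists (tup s), (tup t); apply: Or31; apply: bits_inj; rewrite bits_point.
move=> vst; exists (tup s), (tup t); move: vst.
case: ifP => [st /eqP vst | /norP[st0 /norP[st1 st2]] /eqP vst].
  have vE : v = E (tup s) + E (tup t).
    by apply: bits_inj; rewrite bitsD !bits_point.
  by apply: Or32; case/or3P: st => /eqP st; [exists 0 | exists 1 | exists 2] => //;
     rewrite /= /tnth /= st.
have ord3_inj : injective ord3 by case=> [[]|] [[]|].
apply: Or33; split=> [a | ].
  by case: (I3_split a) => ->; rewrite /tnth /= (inj_eq ord3_inj).
have updE a x : upd (tup s) a x =
    [tuple if 0 == a then x else ord3 s.1.1; if 1 == a then x else ord3 s.1.2;
           if 2 == a then x else ord3 s.2].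
  by apply: eq_from_tnth => b; rewrite tnth_upd; case: (I3_split b) => ->.
have -> : tangent_point (tup s) (tup t) = point (t.1.1, s.1.2, s.2)
    + point (s.1.1, t.1.2, s.2) + point (s.1.1, s.1.2, t.2).
  by rewrite /tangent_point !big_ord_recl big_ord0 addr0 addrA !updE.
by apply: bits_inj; rewrite !bitsD !bits_point.
Qed.

(** * The hyperbolic quadric *)
Lemma segre_span_singular (X : seq V8) :
  (forall x, x \in X -> exists t, x = E t) ->
  {in X &, forall x y, B x y = 0} -> {in <<X>>%VS, forall v, q v = 0}.
Proof.
move=> XE BX; apply: span_singular => //; first exact: Q2_polar_additive.
by move=> x /XE[t ->]; apply: pvalQ2_E.
Qed.

Lemma flat3_singular a c v : v \in flat3 a c -> q v = 0.
Proof.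
move: v; apply: segre_span_singular => [x | x y].
  by rewrite mem_enum => /imsetP[t _ ->]; exists t.
rewrite !mem_enum => /imsetP[s + ->] /imsetP[t + ->].
by rewrite !inE => /eqP sc /eqP tc; apply: (polarQ2_E_agree (a := a)); rewrite sc.
Qed.

Lemma generators_throughP s G :
  reflect (exists a, G = generator a s) (G \in generators_through (E s)).
Proof.
apply: (iffP idP) => [| [a ->]].
  rewrite inE => /andP[/imset2P[a t _ _ ->] /imsetP[r + /E_inj sr]].
  rewrite inE -sr => /agree_offP st; exists a.
  have agree_st r' : agree_off a r' t = agree_off a r' s.
    by apply/agree_offP/agree_offP => r's b ne_ba; rewrite r's ?st.
  by apply/setP => x; apply/imsetP/imsetP => -[r' r'P ->]; exists r' => //;
     move: r'P; rewrite !inE -/(agree_off _ _ _) -/(agree_off _ _ _) agree_st.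
rewrite inE imset2_f //=; apply: imset_f; rewrite inE.
by apply/agree_offP.
Qed.

Lemma mem_generator a s r : (E r \in generator a s) = agree_off a r s.
Proof. by rewrite mem_imset ?inE //; apply: E_inj. Qed.

(** Any two points on generators through E s share an index with each other: the
    places a and b of change leave a third place where both agree with s. *)
Lemma pairwise_agree s a b x y : agree_off a x s -> agree_off b y s ->
  exists c, tnth x c = tnth y c.
Proof.
move=> /agree_offP xs /agree_offP ys; have [c /andP[ca cb]] := third_index a b.
by exists c; rewrite xs ?ys.
Qed.

Lemma tangent_singular s x : x \in distinguished_tangent (E s) -> q x = 0.
Proof.
case/setU1P => [-> | ]; first exact: pvalQ2_E.
rewrite inE => /and3P[_ + _].
have gen y : y \in enum (cover (generators_through (E s))) ->
    exists a, exists2 r, agree_off a r s & y = E r.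
  rewrite mem_enum => /bigcupP[G /generators_throughP[a ->] /imsetP[r ra ->]].
  by exists a, r => //; rewrite inE in ra.
apply: segre_span_singular x => [y /gen[a [r _ ->]] | y z]; first by exists r.
move=> /gen[a [r ra ->]] /gen[b [r' rb ->]].
by have [c rc] := pairwise_agree ra rb; apply: polarQ2_E_agree rc.
Qed.

Lemma H7_singular v : v \in H7 -> v != 0 /\ q v = 0.
Proof.
case/setUP => [/setUP[] | /imsetP[t _ ->]]; last by rewrite E_neq0 pvalQ2_E.
  rewrite inE => /and3P[-> _ /existsP[a /existsP[c]]].
  by move/flat3_singular.
rewrite inE => /and3P[-> _ /exists_inP[_ /imsetP[t _ ->]]].
by move/tangent_singular.
Qed.

Lemma agreeing_sum_flat3 a s t :
  tnth s a = tnth t a -> E s + E t \in flat3 a (tnth s a).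
Proof.
move=> st; rewrite rpredD // memv_span // mem_enum imset_f // inE //.
by rewrite st.
Qed.

(** The plane of the generators in directions a and b is orthogonal to E z, where z
    equals s at the remaining place c and t elsewhere; of the three summands only
    the one changed at c is not orthogonal to E z. *)
Lemma tangent_point_distinguished s t : (forall a, tnth s a != tnth t a) ->
  tangent_point s t != 0 -> tangent_point s t \in distinguished_tangent (E s).
Proof.
move=> st v0; apply/setU1P; right; rewrite inE v0 /=; apply/andP; split.
  apply: rpred_sum => a _; apply: memv_span; rewrite mem_enum.
  apply/bigcupP; exists (generator a s).
    by apply/generators_throughP; exists a.
  by rewrite mem_generator; apply/agree_offP => b /negPf ne_ba; rewrite tnth_upd ne_ba.
apply/forall_inP => G /generators_throughP[a ->].
apply/forall_inP => H /generators_throughP[b ->]; apply/implyP => ne_ab.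
have [c /andP[ne_ca ne_cb]] := third_index a b.
pose z := upd t c (tnth s c).
have Bz : B (E z) (tangent_point s t) = 1.
  have BD x y : B (E z) (x + y) = B (E z) x + B (E z) y.
    exact: polarDr Q2_polar_additive _ _ _.
  have B0 : B (E z) 0 = 0 by rewrite polarC (polar0l Q2_polar_additive).
  rewrite /tangent_point (big_morph _ BD B0) (bigD1 c) //= big1 ?addr0 => [|d ne_dc].
    apply: polarQ2_E_opposite => d; rewrite !tnth_upd.
    by case: (eqVneq d c) => _ //; rewrite eq_sym.
  apply: (polarQ2_E_agree (a := c)); rewrite !tnth_upd eqxx.
  by rewrite eq_sym (negPf ne_dc).
apply/negP => in_plane.
have : B (E z) (tangent_point s t) = 0; last by rewrite Bz.
apply: (span_perp Q2_polar_additive) in_plane => x; rewrite mem_enum.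
have agree_z d r : c != d -> agree_off d r s -> B (E z) (E r) = 0.
  move=> ne_cd /agree_offP rs; apply: (polarQ2_E_agree (a := c)).
  by rewrite tnth_upd eqxx rs.
by case/setUP => /imsetP[r]; rewrite inE => rs ->; apply: agree_z rs.
Qed.

Lemma H7E : H7 = [set v : V8 | (v != 0) && (q v == 0)].
Proof.
apply/setP => v; rewrite [RHS]inE; apply/idP/idP => [/H7_singular[-> ->] // |].
case/andP => v0 /eqP qv; have [Sv | Sv] := boolP (v \in segre).
  by apply/setUP; right.
apply/setUP; left; apply/setUP.
have [s [t [vE | [a st vE] | [st vE]]]] := singular_cases v0 qv.
- by rewrite vE imset_f in Sv.
- left; rewrite inE v0 Sv /=.
  by apply/existsP; exists a; apply/existsP; exists (tnth s a); rewrite vE agreeing_sum_flat3.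
right; rewrite inE v0 Sv /=.
apply/exists_inP; exists (E s); first exact: imset_f.
by rewrite vE tangent_point_distinguished -?vE.
Qed.

Lemma H7_invariant A : A \in GS -> [set v *m A | v in H7] = H7.
Proof.
move=> GA; have injA : injective (fun v : V8 => v *m A).
  exact: can_inj (mulmxK (GS_unit GA)).
apply/eqP; rewrite eqEcard (card_imset _ injA) leqnn andbT H7E.
apply/subsetP => _ /imsetP[v + ->]; rewrite !inE Q2_invariant // => /andP[v0 ->].
by rewrite -(mul0mx _ A) (inj_eq injA) v0.
Qed.

(** The first four basis vectors have third index 0, so they span a totally
    singular subspace of dimension 4. *)
Lemma Q2_hyperbolic : hyperbolic_form q.
Proof.
split; last 1 first.
- exists (<<take 4 e>>)%VS; split.
    have : free (take 4 e ++ drop 4 e) by rewrite cat_take_drop free_e.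
    by move/catl_free/eqnP => ->; rewrite dimvf size_take size_tuple.
  have -> : take 4 e = [seq E t | t <- [:: [tuple 0; 0; 0]; [tuple 1; 0; 0];
      [tuple 1; 1; 0]; [tuple 0; 1; 0]]] by [].
  apply: segre_span_singular => [x /mapP[t _ ->] | x y]; first by exists t.
  move=> /mapP[s s_in ->] /mapP[t t_in ->]; apply: (polarQ2_E_agree (a := 2)).
  have third0 r : r \in [:: [tuple 0; 0; 0]; [tuple 1; 0; 0];
      [tuple 1; 1; 0]; [tuple 0; 1; 0]] -> tnth r 2 = 0.
    by rewrite !inE => /or4P[] /eqP ->.
  by rewrite !third0.
- split=> [a x | y a x z].
    case: (F2_split a) => ->; last by rewrite !scale1r expr1n mul1r.
    by rewrite scale0r expr0n mul0r (polar_additive_eval0 Q2_polar_additive).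
  rewrite Q2_polar_additive; congr (_ + _).
  case: (F2_split a) => ->; last by rewrite scale1r mul1r.
  by rewrite scale0r mul0r (polar0l Q2_polar_additive).
exact: Q2_nondegenerate.
Qed.

Theorem theorem10 :
  (forall P : {mpoly 'F_2[8]},
     [/\ reduced P, pdegree P = 2%N & GS_invariant P] <-> P = Q2) /\
  [/\ O5 \subset H7,
      H7 = [set v : V8 | (v != 0) && (pval Q2 v == 0)],
      (forall A, A \in GS -> [set v *m A | v in H7] = H7) &
      hyperbolic_form (pval Q2)].
Proof.
split; first exact: Q2_unique.
split; [exact: subsetUr | exact: H7E | exact: H7_invariant | exact: Q2_hyperbolic].
Qed.
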